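(* Let $\mathcal{A}$ be a $C^*$-algebra, let $X$ be a right $\mathcal{A}$-module and let $[\cdot,\cdot]$ be a $C^*$-semi-inner product on $X$, with associated norm $|||x|||=\|[x,x]\|^{1/2}$. If $x,y\in X$ and $[x,y]=0$, then $x\perp_B y$, i.e. $|||x+\alpha y|||\geq|||x|||$ for all $\alpha\in\mathbb{C}$.
   Context: Right modules $X$ over a $C^*$-algebra $\mathcal{A}$ are complex vector spaces with compatible scalar multiplication, $\lambda(xa)=(\lambda x)a=x(\lambda a)$ for $\lambda\in\mathbb{C}$, $x\in X$, $a\in\mathcal{A}$ (and $x1=x$ if $\mathcal{A}$ has a unit $1$). For $a\in\mathcal{A}$, $|a|=(a^*a)^{1/2}$, and $\leq$ is the usual order on self-adjoint elements. A $C^*$-semi-inner product on a right $\mathcal{A}$-module $X$ is a mapping $[\cdot,\cdot]:X\times X\to\mathcal{A}$ such that: (i) $[x,x]\geq 0$ for all $x\in X$, and $[x,x]=0$ implies $x=0$; (ii) $[x,\alpha y_1+\beta y_2]=\alpha[x,y_1]+\beta[x,y_2]$ for all $x,y_1,y_2\in X$ and $\alpha,\beta\in\mathbb{C}$; (iii) $[x,ya]=[x,y]a$ and $[xa,y]=a^*[x,y]$ for all $x,y\in X$ and $a\in\mathcal{A}$; (iv) $|[y,x]|^2\leq \|[y,y]\|\,[x,x]$ for all $x,y\in X$. (No additivity in the first variable is assumed.) The function $|||\cdot|||$ is a norm on $X$. Birkhoff-James orthogonality $x\perp_B y$ in a complex normed space means $\|x+\alpha y\|\geq\|x\|$ for every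 scalar $\alpha$. *)

(* Defs.v *)
From HB Require Import structures.
From mathcomp Require Import all_boot all_order all_algebra.
From mathcomp Require Import complex.
From mathcomp Require Import all_classical all_reals all_analysis.

Set Implicit Arguments.
Unset Strict Implicit.
Unset Printing Implicit Defensive.

Import Order.TTheory GRing.Theory Num.Theory.
Import numFieldNormedType.Exports.

Local Open Scope classical_set_scope.
Local Open Scope complex_scope.
Local Open Scope ring_scope.

(* Complex C*-algebras, possibly without unit.  MathComp rings are unital, so
   the product is a field of its own.  The norm takes its values in R[i]; there
   [x <= y] holds iff [y - x] is a nonnegative real. *)
HB.mixin Record isCStarAlgebra (R : realType) A
    of CompleteNormedModule R[i] A := {
  amul : A -> A -> A;
  astar : A -> A;
  amulA : forall a b c : A, amul a (amul b c) = amul (amul a b) c;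
  amulDl : forall a b c : A, amul (a + b) c = amul a c + amul b c;
  amulDr : forall a b c : A, amul a (b + c) = amul a b + amul a c;
  amulZl : forall (l : R[i]) (a b : A), amul (l *: a) b = l *: amul a b;
  amulZr : forall (l : R[i]) (a b : A), amul a (l *: b) = l *: amul a b;
  astarK : forall a : A, astar (astar a) = a;
  astarD : forall a b : A, astar (a + b) = astar a + astar b;
  astarZ : forall (l : R[i]) (a : A), astar (l *: a) = Num.conj l *: astar a;
  astarM : forall a b : A, astar (amul a b) = amul (astar b) (astar a);
  normaM : forall a b : A, `|amul a b| <= `|a| * `|b|;
  normCstar : forall a : A, `|amul (astar a) a| = `|a| ^+ 2
}.

#[short(type="cstarAlgType")]
HB.structure Definition CStarAlgebra (R : realType) :=
  { A of isCStarAlgebra R A & CompleteNormedModule R[i] A }.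

Definition is_unit_element (R : realType) (A : cstarAlgType R) (e : A) : Prop :=
  forall a : A, amul e a = a /\ amul a e = a.

(* Product of the unitization A (+) C, where (a, l) stands for a + l 1. *)
Definition umul (R : realType) (A : cstarAlgType R) (u v : A * R[i])
    : A * R[i] :=
  (amul u.1 v.1 + u.2 *: v.1 + v.2 *: u.1, u.2 * v.2).

(* Spectrum in the unitization.  When A is already unital this only adds the
   point 0 to the spectrum in A, which does not affect positivity. *)
Definition spectrum (R : realType) (A : cstarAlgType R) (a : A) : set R[i] :=
  [set l | ~ exists u : A * R[i],
     umul u (a, - l) = (0, 1) /\ umul (a, - l) u = (0, 1)].

Definition self_adjoint (R : realType) (A : cstarAlgType R) (a : A) : Prop :=
  astar a = a.

Definition positive_element (R : realType) (A : cstarAlgType R) (a : A)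
    : Prop :=
  self_adjoint a /\ forall l, spectrum a l -> 0 <= l.

Definition cstar_le (R : realType) (A : cstarAlgType R) (a b : A) : Prop :=
  [/\ self_adjoint a, self_adjoint b & positive_element (b - a)].

(* |a| = (a^* a)^(1/2); the positive square root exists and is unique in every
   C*-algebra, so the default value 0 is never used spuriously. *)
Definition cstar_abs (R : realType) (A : cstarAlgType R) (a : A) : A :=
  xget 0 [set b : A | positive_element b /\ amul b b = amul (astar a) a].

Record right_module (R : realType) (A : cstarAlgType R) (X : lmodType R[i])
    (act : X -> A -> X) : Prop := RightModule {
  ractDl : forall (x y : X) (a : A), act (x + y) a = act x a + act y a;
  ractDr : forall (x : X) (a b : A), act x (a + b) = act x a + act x b;
  ractM : forall (x : X) (a b : A), act x (amul a b) = act (act x a) b;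
  ractZl : forall (l : R[i]) (x : X) (a : A), l *: act x a = act (l *: x) a;
  ractZr : forall (l : R[i]) (x : X) (a : A), act (l *: x) a = act x (l *: a);
  ract1 : forall e : A, is_unit_element e -> forall x : X, act x e = x
}.

Record cstar_semi_inner_product (R : realType) (A : cstarAlgType R)
    (X : lmodType R[i]) (act : X -> A -> X) (sip : X -> X -> A) : Prop :=
    CStarSemiInnerProduct {
  sip_ge0 : forall x : X, cstar_le 0 (sip x x);
  sip_def : forall x : X, sip x x = 0 -> x = 0;
  sip_linear : forall (x y1 y2 : X) (al be : R[i]),
    sip x (al *: y1 + be *: y2) = al *: sip x y1 + be *: sip x y2;
  sip_actr : forall (x y : X) (a : A), sip x (act y a) = amul (sip x y) a;
  sip_actl : forall (x y : X) (a : A),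
    sip (act x a) y = amul (astar a) (sip x y);
  sip_cauchy_schwarz : forall x y : X,
    cstar_le (amul (cstar_abs (sip y x)) (cstar_abs (sip y x)))
             (`|sip y y| *: sip x x)
}.

Definition sip_norm (R : realType) (A : cstarAlgType R) (X : lmodType R[i])
    (sip : X -> X -> A) (x : X) : R[i] :=
  sqrtC `|sip x x|.

Definition birkhoff_james (R : realType) (X : lmodType R[i]) (N : X -> R[i])
    (x y : X) : Prop :=
  forall al : R[i], N x <= N (x + al *: y).

(* Main.v *)
(* With z = x + al y, linearity in the second variable gives [x, z] = [x, x], so
   the Cauchy-Schwarz inequality reads c^2 <= |c| [z, z] for c = [x, x], and it
   remains to see that the C*-norm is monotone, i.e. that b - c^2 >= 0 implies
   |c|^2 <= |b|.  Everything rests on two facts about commuting self-adjoint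
   elements of the unitization: |u|^2 <= |u^2 + v^2|, because u is the mean of
   u + i v and its adjoint; and 1 - v is a square when |v| <= 1, by the
   iteration y' = (v + y^2) / 2.  They give |t - p| <= t for p of nonnegative
   spectrum and norm at most t, without the spectral radius formula; applied to
   p = b - c^2 this yields |t + c^2| <= t + |b|, so that |b| - c^2 is a square
   and the first fact concludes. *)
Require Import Defs.
From HB Require Import structures.
From mathcomp Require Import all_boot all_order all_algebra.
From mathcomp Require Import complex.
From mathcomp Require Import all_classical all_reals all_analysis.
From mathcomp Require Import ring lra.
Set Implicit Arguments.
Unset Strict Implicit.
Unset Printing Implicit Defensive.
Import Order.TTheory GRing.Theory Num.Theory.
Import numFieldNormedType.Exports.
Local Open Scope complex_scope.
Local Open Scope ring_scope.

(** * Complex-valued norms read as real numbers *)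

Section NormR.
Context {R : realType}.

(** Norm values in [R[i]] are nonnegative reals; moving them to [R] gives a total order, suprema and
    real square roots. *)
Definition nr (V : normedZmodType R[i]) (x : V) : R := complex.Re `|x|.

Lemma nrE (V : normedZmodType R[i]) (x : V) : `|x| = (nr x)%:C.
Proof. by rewrite RRe_real ?normr_real. Qed.

Lemma nr_ge0 (V : normedZmodType R[i]) (x : V) : 0 <= nr x.
Proof. by rewrite -ler0c -nrE. Qed.

Lemma ler_nrD (V : normedZmodType R[i]) (x y : V) : nr (x + y) <= nr x + nr y.
Proof. by rewrite -lecR rmorphD /= -!nrE ler_normD. Qed.

Lemma nrN (V : normedZmodType R[i]) (x : V) : nr (- x) = nr x.
Proof. by rewrite /nr normrN. Qed.

Lemma nr0 (V : normedZmodType R[i]) : nr (0 : V) = 0.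
Proof. by rewrite /nr normr0. Qed.

Lemma nr_eq0 (V : normedZmodType R[i]) (x : V) : nr x = 0 -> x = 0.
Proof. by move=> x0; apply/eqP; rewrite -normr_eq0 nrE x0. Qed.

Lemma nrZ (V : normedModType R[i]) (l : R[i]) (x : V) :
  nr (l *: x) = nr l * nr x.
Proof. by apply: complexI; rewrite rmorphM /= -!nrE normrZ. Qed.

Lemma nrM (k l : R[i]) : nr (k * l) = nr k * nr l.
Proof. by apply: complexI; rewrite rmorphM /= -!nrE normrM. Qed.

Lemma nr_conj (l : R[i]) : nr (Num.conj l) = nr l.
Proof. by rewrite /nr norm_conjC. Qed.

Lemma nrR (r : R) : nr r%:C = `|r|.
Proof. by rewrite /nr normc_def /= expr0n addr0 sqrtr_sqr. Qed.

Lemma conjR (r : R) : Num.conj r%:C = r%:C.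
Proof. by apply/CrealP/complex_realP; exists r. Qed.

End NormR.

(** * First consequences of the C*-identity *)

Section CStarNorm.
Context {R : realType} {A : cstarAlgType R}.
Implicit Types a b : A.

Lemma nr_amul a b : nr (amul a b) <= nr a * nr b.
Proof. by rewrite -lecR rmorphM /= -!nrE normaM. Qed.

Lemma nr_cstar a : nr (amul (astar a) a) = nr a ^+ 2.
Proof. by apply: complexI; rewrite rmorphXn /= -!nrE normCstar. Qed.

(** The C*-identity gives |b|^2 <= |b^*| |b|; cancelling |b| yields one direction, and b = a^* the
    other. *)
Lemma nr_astar a : nr (astar a) = nr a.
Proof.
have le b : nr b <= nr (astar b).
  have [b0|b0] := eqVneq (nr b) 0; first by rewrite b0 nr_ge0.
  have b1 : 0 < nr b by rewrite lt_neqAle eq_sym b0 nr_ge0.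
  by rewrite -(ler_pM2r b1) -expr2 -nr_cstar nr_amul.
by apply/eqP; rewrite eq_le le -{2}[a]astarK le.
Qed.

Lemma amul0r a : amul 0 a = 0.
Proof. by have := amulZl 0 0 a; rewrite !scale0r. Qed.

Lemma amulr0 a : amul a 0 = 0.
Proof. by have := amulZr 0 a 0; rewrite !scale0r. Qed.

Lemma astar0 : astar (0 : A) = 0.
Proof. by have := astarZ 0 (0 : A); rewrite rmorph0 !scale0r. Qed.

End CStarNorm.

(** * The unitization as a complex algebra *)

Definition unitization (R : realType) (A : cstarAlgType R) : Type :=
  (A * R[i]^o)%type.

Section UnitizationRing.
Context {R : realType} {A : cstarAlgType R}.
Local Notation U := (unitization A).

HB.instance Definition _ := GRing.Lmodule.copy U (A * R[i]^o)%type.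

Lemma umul_assoc : associative (@umul R A : U -> U -> U).
Proof.
move=> [a k] [b l] [c m]; apply: injective_projections; rewrite /= ?mulrA //.
rewrite !(amulDl, amulDr, amulZl, amulZr, scalerDr) !amulA !scalerA.
rewrite [m * k]mulrC [m * l]mulrC -!addrA; congr (_ + _).
rewrite [RHS]addrCA; congr (_ + _).
by rewrite [LHS]addrCA; congr (_ + _); rewrite [LHS]addrCA.
Qed.

Lemma umul_1l : left_id ((0, 1) : U) (@umul R A).
Proof.
by move=> [a k]; rewrite /umul /= amul0r scale1r scaler0 add0r addr0 mul1r.
Qed.

Lemma umul_1r : right_id ((0, 1) : U) (@umul R A).
Proof.
by move=> [a k]; rewrite /umul /= amulr0 scale1r scaler0 !add0r mulr1.
Qed.

Lemma umulDl : left_distributive (@umul R A : U -> U -> U) +%R.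
Proof.
move=> [a k] [b l] [c m]; apply: injective_projections; rewrite /= ?mulrDl //.
rewrite amulDl scalerDl scalerDr [RHS]addrACA; congr (_ + _).
exact: addrACA.
Qed.

Lemma umulDr : right_distributive (@umul R A : U -> U -> U) +%R.
Proof.
move=> [a k] [b l] [c m]; apply: injective_projections; rewrite /= ?mulrDr //.
rewrite amulDr scalerDl scalerDr [RHS]addrACA; congr (_ + _).
exact: addrACA.
Qed.

Lemma unit1_neq0 : ((0, 1) : U) != 0.
Proof. by apply/eqP => -[/eqP]; rewrite oner_eq0. Qed.

HB.instance Definition _ := GRing.Zmodule_isNzRing.Build U
  umul_assoc umul_1l umul_1r umulDl umulDr unit1_neq0.

Lemma umulZl (l : R[i]) (u v : U) : l *: (u * v) = (l *: u) * v.
Proof.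
apply: injective_projections => /=; last exact: mulrA.
by rewrite !scalerDr amulZl !scalerA [l * v.2]mulrC.
Qed.

HB.instance Definition _ := GRing.Lmodule_isLalgebra.Build R[i] U umulZl.

Lemma umulZr (l : R[i]) (u v : U) : l *: (u * v) = u * (l *: v).
Proof.
apply: injective_projections => /=; last exact: mulrCA.
by rewrite !scalerDr amulZr !scalerA [l * u.2]mulrC.
Qed.

HB.instance Definition _ := GRing.Lalgebra_isAlgebra.Build R[i] U umulZr.

End UnitizationRing.

(** * Involution and operator bounds on the unitization *)

Section Unitization.
Context {R : realType} {A : cstarAlgType R}.
Local Notation U := (unitization A).
Implicit Types (u v w : U) (x y : A) (C D : R).

Definition ustar u : U := (astar u.1, Num.conj u.2).

Lemma ustarK : involutive ustar.
Proof. by case=> a l; rewrite /ustar /= astarK conjCK. Qed.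

Lemma ustarD u v : ustar (u + v) = ustar u + ustar v.
Proof. by apply: injective_projections; rewrite /= ?astarD ?rmorphD. Qed.

Lemma ustar0 : ustar 0 = 0.
Proof. by apply: injective_projections; rewrite /= ?astar0 ?rmorph0. Qed.

Lemma ustarZ (l : R[i]) u : ustar (l *: u) = Num.conj l *: ustar u.
Proof. by apply: injective_projections; rewrite /= ?astarZ ?rmorphM. Qed.

Lemma ustarN u : ustar (- u) = - ustar u.
Proof. by rewrite -scaleN1r ustarZ rmorphN1 scaleN1r. Qed.

Lemma ustarB u v : ustar (u - v) = ustar u - ustar v.
Proof. by rewrite ustarD ustarN. Qed.

Lemma ustarM u v : ustar (u * v) = ustar v * ustar u.
Proof.
apply: injective_projections; rewrite /= ?rmorphM 1?mulrC //.
by rewrite !astarD astarM !astarZ addrAC.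
Qed.

Lemma ustar1 : ustar 1 = 1.
Proof. by apply: injective_projections; rewrite /= ?astar0 ?rmorph1. Qed.

(** The product of [u] with [(x, 0)], which stays in the ideal [A]. *)
Definition uact u x : A := amul u.1 x + u.2 *: x.

Lemma uactD u v x : uact (u + v) x = uact u x + uact v x.
Proof. by rewrite /uact /= amulDl scalerDl addrACA. Qed.

Lemma uactZ (l : R[i]) u x : uact (l *: u) x = l *: uact u x.
Proof. by rewrite /uact /= amulZl scalerDr scalerA. Qed.

Lemma uactM u v x : uact (u * v) x = uact u (uact v x).
Proof.
rewrite /uact /= !(amulDl, amulDr, amulZl, amulZr, scalerDr) !amulA !scalerA.
by rewrite -!addrA; congr (_ + _); rewrite addrCA.
Qed.

(** For the [A]-valued inner product x^* y, [ustar u] acts as the adjoint of [u]. *)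
Lemma amul_uact_star u x y :
  amul (astar (uact u x)) y = amul (astar x) (uact (ustar u) y).
Proof.
rewrite /uact /= astarD astarM astarZ amulDl amulDr amulZl amulZr.
by rewrite amulA.
Qed.

(* [ubound u C] says that [u] has norm at most [C] in the C*-norm of the
   unitization, the largest of |u.2| and of the norm of left multiplication by
   [u] on [A].  Keeping |u.2| makes this definite even when [A] has a unit. *)
Definition ubound u C : Prop :=
  nr u.2 <= C /\ forall x, nr (uact u x) <= C * nr x.

Lemma ubound_ge0 u C : ubound u C -> 0 <= C.
Proof. by case=> uC _; apply: le_trans uC; apply: nr_ge0. Qed.

Lemma ubound_le u C D : C <= D -> ubound u C -> ubound u D.
Proof.
move=> CD [uC uC']; split; first exact: le_trans CD.
by move=> x; apply: le_trans (uC' x) _; rewrite ler_wpM2r ?nr_ge0.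
Qed.

Lemma ubound_ex u : ubound u (nr u.1 + nr u.2).
Proof.
split=> [|x]; first by rewrite lerDr nr_ge0.
by rewrite (le_trans (ler_nrD _ _)) // nrZ mulrDl lerD2r nr_amul.
Qed.

Lemma ubounded u : exists C, ubound u C.
Proof. by exists (nr u.1 + nr u.2); apply: ubound_ex. Qed.

Lemma ubound_elt x C : nr x <= C -> ubound (x, 0) C.
Proof.
by move=> xC; apply: ubound_le (ubound_ex _); rewrite /= nrR normr0 addr0.
Qed.

Lemma uboundD u v C D : ubound u C -> ubound v D -> ubound (u + v) (C + D).
Proof.
move=> [uC uC'] [vD vD']; split=> [|x].
  by rewrite (le_trans (ler_nrD _ _)) // lerD.
by rewrite uactD (le_trans (ler_nrD _ _)) // mulrDl lerD.
Qed.

Lemma uboundZ (l : R[i]) u C : ubound u C -> ubound (l *: u) (nr l * C).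
Proof.
move=> [uC uC']; split=> [|x]; first by rewrite /= nrM ler_wpM2l ?nr_ge0.
by rewrite uactZ nrZ -mulrA ler_wpM2l ?nr_ge0.
Qed.

Lemma uboundN u C : ubound u C -> ubound (- u) C.
Proof.
by rewrite -scaleN1r => /(uboundZ (-1)); rewrite nrN nrR normr1 mul1r.
Qed.

Lemma uboundB u v C D : ubound u C -> ubound v D -> ubound (u - v) (C + D).
Proof. by move=> uC /uboundN; apply: uboundD. Qed.

Lemma uboundM u v C D : ubound u C -> ubound v D -> ubound (u * v) (C * D).
Proof.
move=> uC; have C0 := ubound_ge0 uC; case: uC => uC uC' [vD vD'].
split=> [|x]; first by rewrite /= nrM ler_pM ?nr_ge0.
by rewrite uactM -mulrA (le_trans (uC' _)) // ler_wpM2l.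
Qed.

Lemma uboundR (r : R) : 0 <= r -> ubound r%:C%:A r.
Proof.
move=> r0; apply: ubound_le (ubound_ex _).
by rewrite [_.1]scaler0 [_.2]mulr1 nrR nr0 add0r ger0_norm.
Qed.

Lemma ubound0 : ubound 0 0.
Proof. by have := uboundR (lexx (0 : R)); rewrite scale0r. Qed.

(** Operator form of [nr_astar]: |u^* x|^2 = |x^* u u^* x| <= |x| C |u^* x|, then cancel. *)
Lemma ubound_star u C : ubound u C -> ubound (ustar u) C.
Proof.
move=> uC; have C0 := ubound_ge0 uC; case: uC => uC uC'.
split=> [|x]; first by rewrite nr_conj.
set y := uact (ustar u) x.
have [y0|y0] := eqVneq (nr y) 0; first by rewrite y0 mulr_ge0 ?nr_ge0.
have y1 : 0 < nr y by rewrite lt_neqAle eq_sym y0 nr_ge0.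
rewrite -(ler_pM2r y1) -expr2 -nr_cstar {1}/y amul_uact_star ustarK.
rewrite (le_trans (nr_amul _ _)) // nr_astar -mulrA [leRHS]mulrCA.
by rewrite ler_wpM2l ?nr_ge0.
Qed.

(** On [A], |u x|^2 = |x^* u^* u x| <= |x| C^2 |x|. *)
Lemma ubound_cstar u C : 0 <= C -> ubound (ustar u * u) (C ^+ 2) -> ubound u C.
Proof.
move=> C0 [uC uC']; split=> [|x].
  by rewrite -(@ler_pXn2r _ 2) ?nnegrE ?nr_ge0 // expr2 -{1}nr_conj -nrM.
rewrite -(@ler_pXn2r _ 2) ?nnegrE ?mulr_ge0 ?nr_ge0 // -nr_cstar.
rewrite amul_uact_star -uactM (le_trans (nr_amul _ _)) // nr_astar.
by rewrite mulrC exprMn [nr x ^+ 2]expr2 mulrA ler_wpM2r ?nr_ge0.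
Qed.

(** Allows an arbitrarily small error in estimates; it serves limits and the infimum of all
    bounds. *)
Lemma ubound_closed u C : (forall e, 0 < e -> ubound u (C + e)) -> ubound u C.
Proof.
move=> uC; split=> [|x].
  by apply/ler_addgt0Pr => e /uC[].
have [x0|x0] := eqVneq (nr x) 0.
  by have [_ /(_ x)] := uC _ ltr01; rewrite x0 !mulr0.
have x1 : 0 < nr x by rewrite lt_neqAle eq_sym x0 nr_ge0.
apply/ler_addgt0Pr => e e0; have [_ /(_ x)] := uC _ (divr_gt0 e0 x1).
by rewrite mulrDl divfK.
Qed.

(** The action is tested on x^*, where |x x^*| = |x|^2. *)
Lemma ubound_elt_le x C : ubound (x, 0) C -> nr x <= C.
Proof.
move=> xC; have C0 := ubound_ge0 xC; case: xC => _ /(_ (astar x)).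
rewrite /uact /= scale0r addr0 -{1}[x]astarK nr_cstar nr_astar expr2.
have := nr_ge0 x; rewrite le_eqVlt => /orP[/eqP <- //|x0].
by rewrite ler_pM2r.
Qed.

Lemma ubound_eq0 u : ubound u 0 -> u = 0.
Proof.
move=> [u0 u0']; have e2 : u.2 = 0.
  by apply: nr_eq0; apply: le_anti; rewrite u0 nr_ge0.
have e1 : u.1 = 0.
  apply: nr_eq0; apply: le_anti; rewrite nr_ge0 andbT.
  by apply: ubound_elt_le; rewrite -e2 -surjective_pairing.
by rewrite [u]surjective_pairing e1 e2.
Qed.

(** Commutation cancels the cross terms of w^* w for [w = u + 'i *: v], leaving u^2 + v^2, so
    [ubound_cstar] bounds [w]. *)
Lemma ubound_sum_squares u v C : 0 <= C -> ustar u = u -> ustar v = v ->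
  GRing.comm u v -> ubound (u ^+ 2 + v ^+ 2) (C ^+ 2) -> ubound u C.
Proof.
move=> C0 uu vv uv uvC; pose w := u + 'i *: v.
have wC : ubound w C.
  apply: ubound_cstar => //; rewrite ustarD ustarZ uu vv conjCi scaleNr.
  rewrite mulrBl !mulrDr -!scalerAl -!scalerAr scalerA.
  rewrite -['i * 'i]expr2 sqrCi scaleN1r.
  by rewrite uv opprD opprK addrA addrK -!expr2.
have -> : u = (2^-1)%:C *: (w + ustar w).
  rewrite ustarD ustarZ uu vv conjCi scaleNr addrACA subrr addr0.
  rewrite -mulr2n -[u *+ 2]scaler_nat scalerA -(rmorph_nat (real_complex R)).
  by rewrite -rmorphM mulVf ?pnatr_eq0 // scale1r.
have := uboundZ (2^-1)%:C (uboundD wC (ubound_star wC)).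
rewrite nrR ger0_norm ?invr_ge0 ?ler0n //.
by have -> : 2^-1 * (C + C) = C by field.
Qed.

End Unitization.

(** * Limits and square roots in the unitization *)

Lemma cauchy_limit (K : numFieldType) (V : completeNormedModType K)
    (x : nat -> V) :
  (forall e, 0 < e -> exists N, forall n, (N <= n)%N -> `|x N - x n| <= e) ->
  exists l, forall e, 0 < e ->
    exists N, forall n, (N <= n)%N -> `|l - x n| <= e.
Proof.
move=> xC; have /cvg_ex[l /cvgrPdist_le xl] : cvgn x.
  apply: cauchy_cvg; apply: cauchy_exP => e e0.
  have [N xN] := xC _ (divr_gt0 e0 (ltr0n K 2)).
  exists (x N); exists N => // n /= /xN xNn.
  rewrite -ball_normE /=; apply: le_lt_trans xNn _.
  by rewrite ltr_pdivrMr ?ltr0n // mulr_natr mulr2n ltrDl.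
exists l => e /xl[N _ xN]; exists N => n; exact: xN.
Qed.

Section SquareRoot.
Context {R : realType} {A : cstarAlgType R}.
Local Notation U := (unitization A).
Implicit Types (u v w : U) (C D : R).

Lemma ustar_real u : ustar u = u -> exists r : R, u.2 = r%:C.
Proof. by move=> /(congr1 snd)/= /CrealP/complex_realP. Qed.

(* The scalars of the unitization form the field R[i], which carries no
   completeness instance; for self-adjoint elements they are real. *)
Lemma ubound_limit (y : nat -> U) :
  (forall n, ustar (y n) = y n) ->
  (forall e, 0 < e -> exists N, forall n, (N <= n)%N -> ubound (y N - y n) e) ->
  exists2 l, ustar l = l & forall e, 0 < e ->
    exists N, forall n, (N <= n)%N -> ubound (l - y n) e.
Proof.
move=> yy yC; have /choice[r yr] n := ustar_real (yy n).
have [b yb] : exists b : A, forall e : R[i], 0 < e ->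
    exists N, forall n, (N <= n)%N -> `|b - (y n).1| <= e.
  apply: cauchy_limit => e e0.
  have ere : e = (complex.Re e)%:C by rewrite RRe_real // gtr0_real.
  (* One half is for the difference itself, the other for removing its scalar part. *)
  have e2 : 0 < complex.Re e / 2 by rewrite divr_gt0 // -ltcR -ere.
  have [N yN] := yC _ e2; exists N => n /yN yNn.
  rewrite ere nrE lecR; apply: ubound_elt_le.
  have -> : ((y N).1 - (y n).1, 0) = (y N - y n) - (r N - r n)%:C%:A :> U.
    apply: injective_projections => /=; first by rewrite scaler0 subr0.
    by rewrite !yr [_ *: _]mulr1 rmorphB subrr.
  rewrite [complex.Re e]splitr; apply: uboundB => //.
  apply: ubound_le (ubound_ex _).
  case: yNn => + _; rewrite /= scaler0 nr0 add0r !yr [_ *: _]mulr1.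
  by rewrite rmorphB.
have [s ys] : exists s : R, forall e : R, 0 < e ->
    exists N, forall n, (N <= n)%N -> `|s - r n| <= e.
  apply: cauchy_limit => e /yC[N yN]; exists N => n /yN[+ _].
  by rewrite /= !yr -rmorphB nrR.
have lim e : 0 < e ->
    exists N, forall n, (N <= n)%N -> ubound (((b, s%:C) : U) - y n) e.
  move=> e0; have e2 : 0 < e / 2 by rewrite divr_gt0.
  have e2C : 0 < (e / 2)%:C by rewrite ltcR.
  have [[N bN] [M sM]] := (yb _ e2C, ys _ e2).
  exists (maxn N M) => n; rewrite geq_max => /andP[/bN + /sM].
  rewrite nrE lecR => bn sn; apply: ubound_le (ubound_ex _).
  by rewrite /= yr -rmorphB nrR [e]splitr lerD.
exists (b, s%:C) => //; apply/eqP; rewrite -subr_eq0; apply/eqP.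
apply: ubound_eq0; apply: ubound_closed => e e0; rewrite add0r.
have [N /(_ N (leqnn N)) yN] := lim _ (divr_gt0 e0 (ltr0n R 2)).
rewrite -(subrK (y N) (ustar _)) -addrA -{1}yy -ustarB [e]splitr.
apply: uboundD; first exact: ubound_star.
by rewrite -opprB; apply: uboundN.
Qed.

(** A fixed point y of the iteration satisfies (1 - y)^2 = 1 - v. *)
Fixpoint sqrt_iter (v : U) (n : nat) : U :=
  if n is m.+1 then (2^-1)%:C *: (v + sqrt_iter v m ^+ 2) else 0.

Fixpoint sqrt_bound (n : nat) : R :=
  if n is m.+1 then 2^-1 * (1 + sqrt_bound m ^+ 2) else 0.

Lemma sqrt_bound_itv n : 0 <= sqrt_bound n <= 1.
Proof.
elim: n => [|n /andP[s0 s1]] /=; first by rewrite lexx ler01.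
by apply/andP; split; nra.
Qed.

Lemma commrZ (l : R[i]) u v : GRing.comm u v -> GRing.comm u (l *: v).
Proof. by move=> uv; rewrite /GRing.comm -scalerAl -scalerAr uv. Qed.

Lemma ustar_sqr u : ustar u = u -> ustar (u ^+ 2) = u ^+ 2.
Proof. by move=> uu; rewrite expr2 ustarM uu. Qed.

Lemma sqrt_iter_star v n : ustar v = v -> ustar (sqrt_iter v n) = sqrt_iter v n.
Proof.
move=> vv; elim: n => [|n IHn] /=; first exact: ustar0.
by rewrite ustarZ conjR ustarD vv ustar_sqr.
Qed.

Lemma sqrt_iter_comm u v n : GRing.comm u v -> GRing.comm u (sqrt_iter v n).
Proof.
move=> uv; elim: n => [|n IHn] /=; first exact: commr0.
by apply: commrZ; apply: commrD => //; apply: commrX.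
Qed.

Lemma half_bound u C : ubound u C -> ubound ((2^-1)%:C *: u) (2^-1 * C).
Proof.
by move=> /(uboundZ (2^-1)%:C); rewrite nrR ger0_norm // invr_ge0 ler0n.
Qed.

Lemma sqrt_iter_bound v n : ubound v 1 -> ubound (sqrt_iter v n) (sqrt_bound n).
Proof.
move=> v1; elim: n => [|n IHn] /=; first exact: ubound0.
by apply: half_bound; apply: uboundD => //; apply: uboundM.
Qed.

Lemma subr_sqr_comm u v : GRing.comm u v ->
  u ^+ 2 - v ^+ 2 = (u - v) * (u + v).
Proof.
by move=> uv; rewrite mulrBl !mulrDr uv opprD addrA addrK -!expr2.
Qed.

(** The next increment is half of (y' - y)(y' + y), for the elements as for the scalars, so the
    bound propagates by induction. *)
Lemma sqrt_iter_step v n : ubound v 1 ->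
  ubound (sqrt_iter v n.+1 - sqrt_iter v n) (sqrt_bound n.+1 - sqrt_bound n).
Proof.
move=> v1; elim: n => [|n IHn].
  by rewrite /= !subr0 !expr0n !addr0; apply: half_bound.
rewrite [sqrt_iter v n.+2]/= [X in _ - X]/= -scalerBr opprD addrACA subrr add0r.
have -> : sqrt_bound n.+2 - sqrt_bound n.+1 = 2^-1 *
    ((sqrt_bound n.+1 - sqrt_bound n) * (sqrt_bound n.+1 + sqrt_bound n)).
  by rewrite /=; ring.
apply: half_bound; rewrite -/(sqrt_iter v n.+1) subr_sqr_comm; last first.
  by apply: sqrt_iter_comm; apply: commr_sym; apply: sqrt_iter_comm.
by apply: uboundM => //; apply: uboundD; apply: sqrt_iter_bound.
Qed.

Lemma sqrt_iter_dist v m n : ubound v 1 -> (m <= n)%N ->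
  ubound (sqrt_iter v m - sqrt_iter v n) (sqrt_bound n - sqrt_bound m).
Proof.
move=> v1; elim: n => [|n IHn].
  by rewrite leqn0 => /eqP ->; rewrite !subrr; apply: ubound0.
rewrite leq_eqVlt => /orP[/eqP ->|/IHn mn].
  by rewrite !subrr; apply: ubound0.
rewrite -(subrKA (sqrt_iter v n)) -(subrKA (sqrt_bound n)).
rewrite [X in ubound _ X]addrC; apply: uboundD => //.
rewrite -(opprB (sqrt_iter v n.+1)); apply: uboundN.
exact: sqrt_iter_step.
Qed.

Lemma commr_limit u l (y : nat -> U) : (forall n, GRing.comm u (y n)) ->
  (forall e, 0 < e -> exists n, ubound (l - y n) e) -> GRing.comm u l.
Proof.
move=> uy yl; have [B uB] := ubounded u.
have B0 := ubound_ge0 uB.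
apply/eqP; rewrite -subr_eq0; apply/eqP; apply: ubound_eq0.
apply: ubound_closed => e e0; rewrite add0r.
(* The commutator is bounded by 2 B times the bound on [l - y n]; adding 1 keeps the divisor
   positive when [B] is 0. *)
have B1 : 0 < 2 * B + 1 by lra.
have [n yn] := yl _ (divr_gt0 e0 B1).
have -> : u * l - l * u = u * (l - y n) - (l - y n) * u.
  by rewrite mulrBr mulrBl uy opprB addrA subrK.
apply: ubound_le (uboundB (uboundM uB yn) (uboundM yn uB)).
have d0 : 0 < e / (2 * B + 1) by rewrite divr_gt0.
by rewrite -[leRHS](divfK (lt0r_neq0 B1)); nra.
Qed.

(** Past an index within [e] of the supremum, later values exceed [sqrt_bound N] by less than [e];
    with [sqrt_iter_dist] this makes the iterates Cauchy. *)
Lemma sqrt_bound_sup : exists S : R,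
  (forall n, sqrt_bound n <= S) /\
  forall e, 0 < e -> exists N, S - e < sqrt_bound N.
Proof.
have s1 : has_sup (range sqrt_bound).
  split; first by exists 0, 0%N.
  by exists 1 => _ [n _ <-]; case/andP: (sqrt_bound_itv n).
exists (sup (range sqrt_bound)); split=> [n|e e0].
  by apply: ub_le_sup; [case: s1 | exists n].
by have [_ [N _ <-] sN] := sup_adherent e0 s1; exists N.
Qed.

(* [y = 1 - (1 - v)^(1/2)] is the limit of [y' = (v + y^2) / 2].  The same
   iteration on scalars with [v] replaced by its bound 1 majorizes every step,
   so it converges even when [v] has norm exactly 1. *)
Lemma ubound_sqrt v : ustar v = v -> ubound v 1 ->
  exists j, [/\ ustar j = j, j ^+ 2 = 1 - v &
    forall u, GRing.comm u v -> GRing.comm u j].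
Proof.
move=> vv v1; have [S [sS Ss]] := sqrt_bound_sup.
have [|y yy yl] := ubound_limit (fun n => sqrt_iter_star n vv).
  move=> e /Ss[N SN]; exists N => n Nn.
  by apply: ubound_le (sqrt_iter_dist v1 Nn); have := sS n; lra.
have ycomm u : GRing.comm u v -> GRing.comm u y.
  move=> uv; apply: (commr_limit (y := sqrt_iter v)) => [n|e /yl[N yN]].
    exact: sqrt_iter_comm.
  by exists N; apply: yN.
have [B yB] := ubounded y.
have B0 := ubound_ge0 yB.
(* Both sides are compared with iterate N + 1: for d = e / (B + 2) the error is at most d + d (B +
   1) / 2 <= e. *)
have yE : y = (2^-1)%:C *: (v + y ^+ 2).
  apply/eqP; rewrite -subr_eq0; apply/eqP; apply: ubound_eq0.
  apply: ubound_closed => e e0; rewrite add0r.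
  have B1 : 0 < B + 2 by lra.
  have d0 : 0 < e / (B + 2) by rewrite divr_gt0.
  have [N yN] := yl _ d0; have yN0 := yN _ (leqnn N).
  rewrite -(subrKA (sqrt_iter v N.+1)).
  have -> : sqrt_iter v N.+1 - (2^-1)%:C *: (v + y ^+ 2) =
      - ((2^-1)%:C *: ((y - sqrt_iter v N) * (y + sqrt_iter v N))).
    rewrite /= -subr_sqr_comm; last first.
      by apply: sqrt_iter_comm; apply: commr_sym; apply: ycomm.
    by rewrite -scalerBr opprD addrACA subrr add0r -scalerN opprB.
  apply: ubound_le (uboundB (yN _ (leqnSn N)) (half_bound (uboundM yN0
    (uboundD yB (sqrt_iter_bound N v1))))).
  have /andP[s0 s1] := sqrt_bound_itv N.
  by rewrite -[leRHS](divfK (lt0r_neq0 B1)); nra.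
exists (1 - y); split=> [||u uv].
- by rewrite ustarB ustar1 yy.
- rewrite expr2 mulrBl mul1r mulrBr mulr1 -expr2.
  have y2 : y + y = v + y ^+ 2.
    rewrite -mulr2n -scaler_nat {1}yE scalerA -(rmorph_nat (real_complex R)).
    by rewrite -rmorphM mulfV ?pnatr_eq0 // scale1r.
  rewrite opprB addrCA -addrA -opprD y2 addrCA opprD.
  by rewrite [X in _ + X]addrCA subrr addr0.
- by apply: commrB; [apply: commr1 | apply: ycomm].
Qed.

End SquareRoot.

(** * Positivity and monotonicity of the norm *)

Section OrderNorm.
Context {R : realType} {A : cstarAlgType R}.
Local Notation U := (unitization A).
Implicit Types (u v w p : U) (C D : R).

Lemma ustarR (r : R) : ustar (r%:C%:A : U) = r%:C%:A.
Proof. by rewrite ustarZ conjR ustar1. Qed.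

Lemma commrR (r : R) u : GRing.comm u r%:C%:A.
Proof. by apply: commrZ; apply: commr1. Qed.

(** The root is sqrt r times a root of 1 - v / r. The last clause provides the commutation that
    [ubound_sum_squares] requires. *)
Lemma ubound_sqrt_scaled v (r : R) : 0 < r -> ustar v = v -> ubound v r ->
  exists j, [/\ ustar j = j, j ^+ 2 = r%:C%:A - v &
    forall u, GRing.comm u v -> GRing.comm u j].
Proof.
move=> r0 vv vr; have rn0 := lt0r_neq0 r0.
have [||j [jj j2 jc]] := @ubound_sqrt R A ((r^-1)%:C *: v).
- by rewrite ustarZ conjR vv.
- have := uboundZ (r^-1)%:C vr.
  by rewrite nrR ger0_norm ?mulVf // invr_ge0 ltW.
exists ((Num.sqrt r)%:C *: j); split=> [||u uv].
- by rewrite ustarZ conjR jj.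
- rewrite exprZn j2 -rmorphXn /= sqr_sqrtr ?(ltW r0) // scalerBr scalerA.
  by rewrite -rmorphM mulfV // scale1r.
- by apply: commrZ; apply: jc; apply: commrZ.
Qed.

Lemma inverse_comm u v w : w * v = 1 -> v * w = 1 ->
  GRing.comm u v -> GRing.comm u w.
Proof.
move=> wv vw uv; rewrite /GRing.comm -[u * w]mul1r -{1}wv -!mulrA.
by rewrite (mulrA v) -uv -mulrA vw mulr1.
Qed.

Lemma inverse_star v w : w * v = 1 -> v * w = 1 ->
  ustar v = v -> ustar w = w.
Proof.
move=> wv vw vv; rewrite -[LHS]mulr1 -vw mulrA -{1}vv -ustarM vw ustar1.
by rewrite mul1r.
Qed.

(* If the best bound [m] of [t - p] were larger than [t], then [p + (m - t)]
   would be an invertible square, hence [p + (m - t) - d] would still be a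
   square for some [d > 0]; adding the square [t - p] shows that [m - d]
   bounds [t - p]. *)
Lemma ubound_nonneg_spectrum p (t : R) : ustar p = p -> 0 < t -> ubound p t ->
  (forall l : R, 0 < l ->
     exists w, w * (p + l%:C%:A) = 1 /\ (p + l%:C%:A) * w = 1) ->
  ubound (t%:C%:A - p) t.
Proof.
move=> pp t0 pt pinv; pose q : U := t%:C%:A - p.
have qq : ustar q = q by rewrite ustarB ustarR pp.
have [k' [k'k' k'2 k'c]] := ubound_sqrt_scaled t0 pp pt.
(* [m] is the least bound of [q], attained by [ubound_closed]. *)
pose E : set R := [set m | ubound q m]%classic; pose m := inf E.
have Elb : has_lbound E by exists 0 => x /ubound_ge0.
have Einf : has_inf E.
  split=> //; exists (t + t); apply: uboundB => //.
  by apply: uboundR; apply: ltW.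
have qm : ubound q m.
  apply: ubound_closed => e /(inf_adherent)/(_ Einf)[x Ex xm].
  exact: ubound_le (ltW xm) Ex.
have [/ubound_le|tm] := leP m t; first by apply.
have e0 : 0 < m - t by rewrite subr_gt0.
have m0 : 0 < m by exact: lt_trans tm.
have [w [wp pw]] := pinv _ e0.
set s := p + _ in wp pw.
have ss : ustar s = s by rewrite ustarD ustarR pp.
have ww := inverse_star wp pw ss.
have [B wB] := ubounded w.
have B0 := ubound_ge0 wB.
(* The first term keeps [m - d] nonnegative; the second gives [d * B <= 1], so that 1 - d w has a
   square root. *)
pose d := Num.min (m - t) (B + 1)^-1.
have d0 : 0 < d by rewrite lt_min e0 invr_gt0; lra.
have dm : d <= m - t by rewrite ge_min lexx.
have dB : d * B <= 1.
  have B1 : 0 < B + 1 by lra.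
  have dB1 : d <= (B + 1)^-1 by rewrite ge_min lexx orbT.
  apply: le_trans (_ : d * (B + 1) <= 1); first by nra.
  by rewrite -ler_pdivlMr // mul1r.
(* Since m - q = p + (m - t), a root of m - q is a root of [s]. *)
have [k [kk k2 kc]] := ubound_sqrt_scaled m0 qq qm.
have {}k2 : k ^+ 2 = s.
  by rewrite k2 /q opprB addrCA -scalerBl -rmorphB.
have [||l [ll l2 lc]] := @ubound_sqrt R A (d%:C *: w).
- by rewrite ustarZ conjR ww.
- apply: ubound_le dB _; have := uboundZ d%:C wB.
  by rewrite nrR ger0_norm // ltW.
have scomm u : GRing.comm u p -> GRing.comm u s.
  by move=> up; apply: commrD => //; apply: commrR.
have qcomm u : GRing.comm u p -> GRing.comm u q.
  by move=> up; apply: commrB => //; apply: commrR.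
have wcomm u : GRing.comm u p -> GRing.comm u (d%:C *: w).
  by move=> up; apply: commrZ; apply: inverse_comm wp pw _; apply: scomm.
have kp : GRing.comm k p.
  by apply: commr_sym; apply: kc; apply: qcomm.
have kl : GRing.comm k l by apply/lc/wcomm.
have k'p : GRing.comm k' p by apply: commr_sym; apply: k'c.
have jj : ustar (k * l) = k * l by rewrite ustarM ll kk kl.
(* As s w = 1, s (1 - d w) = s - d. *)
have j2 : (k * l) ^+ 2 = s - d%:C%:A.
  by rewrite exprMn_comm // k2 l2 mulrBr mulr1 -scalerAr pw.
have k'j : GRing.comm k' (k * l).
  by apply: commrM; [apply/kc/qcomm | apply/lc/wcomm].
have md0 : 0 <= m - d by lra.
have qmd : ubound q (m - d).
  (* The squares of [k'] and [k * l] add up to (t - p) + (s - d) = m - d, and [q] is the square of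
     [k']. *)
  have k'b : ubound k' (Num.sqrt (m - d)).
    apply: ubound_sum_squares (k'j) _ => //.
    rewrite k'2 j2 sqr_sqrtr //.
    have -> : t%:C%:A - p + (s - d%:C%:A) = (m - d)%:C%:A :> U.
      rewrite /s addrA subrKA -scalerDl -scalerBl -rmorphD -rmorphB.
      by congr (_%:C *: _); ring.
    exact: uboundR.
  by rewrite -(sqr_sqrtr md0) /q -k'2 !expr2; apply: uboundM.
have := ge_inf Elb qmd; rewrite -/m; lra.
Qed.

(** The negative number -l lies outside the spectrum of [a]; [spectrum] subtracts its point, whence
    the double sign in the proof. *)
Lemma positive_inverse (a : A) (l : R) : positive_element a -> 0 < l ->
  exists w : U, w * (((a, 0) : U) + l%:C%:A) = 1 /\
                (((a, 0) : U) + l%:C%:A) * w = 1.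
Proof.
move=> [_ a0] l0; have -> : ((a, 0) : U) + l%:C%:A = (a, - - l%:C).
  apply: injective_projections => /=; first by rewrite scaler0 addr0.
  by rewrite add0r opprK [_ *: _]mulr1.
apply: contrapT => nw; have /a0 : spectrum a (- l%:C) by [].
by rewrite oppr_ge0 lecR leNgt l0.
Qed.

Lemma ustar_elt (a : A) : self_adjoint a -> ustar ((a, 0) : U) = (a, 0).
Proof. by move=> aa; rewrite /ustar /= rmorph0 aa. Qed.

Lemma cstar_le_sqr_norm (c b : A) : self_adjoint c -> cstar_le (amul c c) b ->
  nr c ^+ 2 <= nr b.
Proof.
move=> cc [_ bb p0]; set p := b - amul c c in p0.
(* The summand 1 makes [t] positive even when [p] is 0. *)
pose t := nr p + 1; pose s := nr b; pose a : U := (c, 0).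
have t0 : 0 < t by rewrite ltr_wpDl ?nr_ge0.
have s0 : 0 <= s by exact: nr_ge0.
have st0 : 0 < t + s by lra.
have aa : ustar a = a by exact: ustar_elt.
have a2 : a ^+ 2 = (amul c c, 0).
  rewrite expr2; apply: injective_projections => /=; last exact: mulr0.
  by rewrite scale0r !addr0.
have pE : ((p, 0) : U) = ((b, 0) : U) - a ^+ 2.
  by rewrite a2; apply: injective_projections; rewrite /= ?subr0.
have tp : ubound (t%:C%:A - ((p, 0) : U)) t.
  apply: ubound_nonneg_spectrum => //.
  - by apply: ustar_elt; case: p0.
  - by apply: ubound_elt; rewrite /t; lra.
  - by move=> l; apply: positive_inverse.
pose g : U := t%:C%:A + a ^+ 2.
have gb : ubound g (t + s).
  have -> : g = (t%:C%:A - ((p, 0) : U)) + ((b, 0) : U).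
    by rewrite pE opprB addrA subrK.
  by apply: uboundD => //; apply: ubound_elt.
have gg : ustar g = g by rewrite ustarD ustarR ustar_sqr.
(* Here k^2 = (t + s) - (t + a^2) = s - a^2, so a^2 + k^2 is the scalar [s]. *)
have [k [kk k2 kc]] := ubound_sqrt_scaled st0 gg gb.
have ak : GRing.comm a k.
  by apply: kc; apply: commrD; [apply: commrR | apply: commrX].
have := ubound_sum_squares (sqrtr_ge0 s) aa kk ak.
have -> : a ^+ 2 + k ^+ 2 = s%:C%:A.
  rewrite k2 /g opprD addrCA addrA addrACA subrr addr0 rmorphD scalerDl.
  by rewrite addrAC subrr add0r.
rewrite sqr_sqrtr // => /(_ (uboundR s0))/ubound_elt_le => cs.
by rewrite -[nr b](sqr_sqrtr s0) ler_pXn2r ?nnegrE ?nr_ge0 ?sqrtr_ge0.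
Qed.

End OrderNorm.

(* [a] itself lies in the set that [cstar_abs a] is chosen from, so neither
   existence nor uniqueness of positive square roots is needed. *)
Lemma cstar_abs_sqr (R : realType) (A : cstarAlgType R) (a : A) :
  positive_element a -> amul (cstar_abs a) (cstar_abs a) = amul a a.
Proof.
move=> a0; have aa : astar a = a by case: a0.
rewrite /cstar_abs aa; set S := mkset _.
by have [] : S (xget 0 S) by apply: (@xgetI _ 0 S a).
Qed.

Theorem theorem3p1 (R : realType) (A : cstarAlgType R) (X : lmodType R[i])
  (act : X -> A -> X) (sip : X -> X -> A)
  (hX : right_module act) (hsip : cstar_semi_inner_product act sip)
  (x y : X) (hxy : sip x y = 0) :
  birkhoff_james (sip_norm sip) x y.
Proof.
move=> al; set z := x + _.
have xz : sip x z = sip x x.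
  rewrite /z -[x in x + _]scale1r (sip_linear hsip) hxy scaler0 addr0.
  by rewrite scale1r.
have x0 : positive_element (sip x x).
  by have [_ _] := sip_ge0 hsip x; rewrite subr0.
have := sip_cauchy_schwarz hsip z x.
rewrite xz cstar_abs_sqr // => /(cstar_le_sqr_norm x0.1).
rewrite nrE nrZ nrR ger0_norm ?nr_ge0 // expr2 => xzle.
rewrite /sip_norm ler_sqrtC ?nnegrE ?normr_ge0 // !nrE lecR.
(* In |c|^2 <= |c| |[z, z]| with c = [x, x] the factor |c| cancels, unless it is 0 and the claim is
   trivial. *)
have := nr_ge0 (sip x x); rewrite le_eqVlt => /orP[/eqP <-|n0].
  exact: nr_ge0.
by rewrite -(ler_pM2l n0).
Qed.
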